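(* For every metric space $M$, $\dim_{\mathrm{MST}}(M)=\dim_{\mathrm{Box}}(M)$.
   Context: A minimal spanning tree (MST) on a finite set of points in a metric space is a spanning tree of the complete graph on those points that minimizes the sum of the edge lengths; for an edge $e$, $\|e\|$ is the distance between its endpoints, and for a tree $T$ and $d\ge 0$, $E_d(T)=\sum_{e\in T}\|e\|^d$. The MST dimension is \[ \dim_{\mathrm{MST}}(M):=\inf\{d\ge 0:\ \exists C<\infty \text{ such that } E_d(T)\le C \text{ for every MST } T \text{ on any finite set of distinct points of } M\}, \] with $\inf\emptyset=\infty$. For $\epsilon>0$ let $N(\epsilon)\in\{0,1,2,\dots\}\cup\{\infty\}$ be the maximal number of pairwise disjoint open balls of radius $\epsilon$ centered at points of $M$. The upper box dimension is \[ \dim_{\mathrm{Box}}(M):=\limsup_{\epsilon\to0}\frac{\log N(\epsilon)}{\log(1/\epsilon)}. \] *)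

(* Defs.v *)
From HB Require Import structures.
From mathcomp Require Import all_boot all_order all_algebra.
From mathcomp Require Import all_classical all_reals all_analysis.
Set Implicit Arguments. Unset Strict Implicit. Unset Printing Implicit Defensive.
Import Order.TTheory GRing.Theory Num.Theory.
Local Open Scope classical_set_scope.
Local Open Scope ring_scope.

Section Defs.
Variables (R : realType) (M : Type).

Definition is_metric (d : M -> M -> R) : Prop :=
  [/\ (forall x y, 0 <= d x y),
      (forall x y, d x y = 0 <-> x = y),
      (forall x y, d x y = d y x) &
      (forall x y z, d x z <= d x y + d y z)].

(* A graph on the vertex set 'I_n: a set of edges (i,j) with i < j
   (each unordered pair {i,j} is represented once). *)
Definition simple_edges n (E : {set 'I_n * 'I_n}) : bool :=
  [forall e in E, (e.1 < e.2)%N].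

Definition adj n (E : {set 'I_n * 'I_n}) : rel 'I_n :=
  fun x y => ((x, y) \in E) || ((y, x) \in E).

Definition connected_graph n (E : {set 'I_n * 'I_n}) : Prop :=
  forall x y : 'I_n, connect (adj E) x y.

Definition acyclic_graph n (E : {set 'I_n * 'I_n}) : Prop :=
  forall c : seq 'I_n, uniq c -> (2 < size c)%N -> ~~ cycle (adj E) c.

Definition spanning_tree n (E : {set 'I_n * 'I_n}) : Prop :=
  [/\ simple_edges E, connected_graph E & acyclic_graph E].

Definition edge_energy (d : M -> M -> R) n (p : 'I_n -> M)
    (E : {set 'I_n * 'I_n}) (a : R) : R :=
  \sum_(e in E) (d (p e.1) (p e.2)) `^ a.

Definition is_MST (d : M -> M -> R) n (p : 'I_n -> M) (E : {set 'I_n * 'I_n}) : Prop :=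
  spanning_tree E /\
  forall E' : {set 'I_n * 'I_n}, spanning_tree E' ->
    edge_energy d p E 1 <= edge_energy d p E' 1.

(* dim_MST = inf { a >= 0 | exists C, E_a(T) <= C for every MST T on any
   finite set of distinct points }  (inf of the empty set = +oo) *)
Definition dim_MST (d : M -> M -> R) : \bar R :=
  ereal_inf [set a%:E | a in
    [set a : R | 0 <= a /\
      exists C : R, forall (n : nat) (p : 'I_n -> M), injective p ->
        forall E, is_MST d p E -> edge_energy d p E a <= C]].

Definition disjoint_balls (d : M -> M -> R) (eps : R) (n : nat) (p : nat -> M) : Prop :=
  forall i j, (i < j < n)%N -> forall y : M, ~ (d (p i) y < eps /\ d (p j) y < eps).

Definition packing_number (d : M -> M -> R) (eps : R) : \bar R :=
  ereal_sup [set (n%:R)%:E | n in [set n : nat | exists p, disjoint_balls d eps n p]].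

Definition box_ratio (d : M -> M -> R) (eps : R) : \bar R :=
  match packing_number d eps with
  | EFin N => (ln N / ln (1 / eps))%:E
  | +oo%E => +oo%E
  | -oo%E => -oo%E
  end.

(* limsup_{eps -> 0+} = inf_{0<delta<1} sup_{0<eps<delta} *)
Definition dim_Box (d : M -> M -> R) : \bar R :=
  ereal_inf [set ereal_sup [set box_ratio d eps | eps in [set eps : R | 0 < eps < delta]]
            | delta in [set delta : R | 0 < delta < 1]].

End Defs.

(* Main.v *)
Require Import Defs.
From mathcomp Require Import all_boot all_order all_algebra.
From mathcomp Require Import all_classical all_reals all_analysis.
From mathcomp Require Import lra.
Set Implicit Arguments. Unset Strict Implicit. Unset Printing Implicit Defensive.
Import Order.TTheory GRing.Theory Num.Theory.
Local Open Scope ring_scope.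

(* Upper bound: removing from an MST its edges of length at least t leaves
   components at mutual distance at least t (a shorter link could replace a
   removed edge), so there are at most N(t/2) such edges; if N(t) <= t^-s for
   small t and s < a, summing over dyadic scales bounds E_a uniformly.
   Lower bound: the n centres of disjoint eps-balls are at mutual distance at
   least eps, and every vertex lies on an edge, so an MST on them has at least
   n/2 edges and E_a >= (n/2) eps^a, whence N(eps) = O(eps^-a). *)

(** * Connectivity, bridges and spanning trees in finite graphs *)

Section Graphs.
Import fintype mathcomp.boot.finset.
Variable n : nat.
Implicit Types (E F G L : {set 'I_n * 'I_n}) (e : 'I_n * 'I_n) (x y : 'I_n).

Lemma adj_sym E : symmetric (adj E).
Proof. by move=> x y; rewrite /adj orbC. Qed.

Lemma connect_adj_sym E : connect_sym (adj E).
Proof. exact: sym_connect_sym (adj_sym E). Qed.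

Lemma connect_edge E e : e \in E -> connect (adj E) e.1 e.2.
Proof. by move=> eE; apply: connect1; rewrite /adj -surjective_pairing eE. Qed.

Lemma connect_adj_sub E F :
  (forall e, e \in E -> connect (adj F) e.1 e.2) ->
  subrel (connect (adj E)) (connect (adj F)).
Proof.
move=> EF; apply: connect_sub => x y /orP[] /EF //=.
by rewrite connect_adj_sym.
Qed.

Lemma connect_adjS E F : E \subset F -> subrel (connect (adj E)) (connect (adj F)).
Proof. by move=> /subsetP EF; apply: connect_adj_sub => e /EF /connect_edge. Qed.

Lemma connected_setD1 E e : connected_graph E ->
  connect (adj (E :\ e)) e.1 e.2 -> connected_graph (E :\ e).
Proof.
move=> cE ce x y; apply: connect_adj_sub (cE x y) => f fE.
have [->//|fe] := eqVneq f e.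
by apply: connect_edge; rewrite !inE fe.
Qed.

(** Induction on the path: crossing [e] and later crossing it back cancels, so one crossing at most
    is needed, in one direction or the other. *)
Lemma connect_setU1 G e x y : connect (adj (e |: G)) x y ->
  [\/ connect (adj G) x y,
      connect (adj G) x e.1 /\ connect (adj G) e.2 y |
      connect (adj G) x e.2 /\ connect (adj G) e.1 y].
Proof.
move=> /connectP[p + ->] {y}; elim: p x => [|z p IH] x /=.
  by move=> _; apply: Or31.
case/andP=> xz /IH {IH}; set y := last z p => IH.
have [xzG|] := boolP (adj G x z).
  have c a : connect (adj G) z a -> connect (adj G) x a.
    exact/connect_trans/connect1.
  by case: IH => [/c|[/c ? ?]|[/c ? ?]]; [apply: Or31|apply: Or32|apply: Or33].
rewrite /adj negb_or => /andP[/negPf xzG /negPf zxG].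
move: xz; rewrite /adj !inE xzG zxG !orbF => /orP[] /eqP ee; move: IH; rewrite -ee /=.
  case=> [?|[_ ?]|[_ ?]]; [by apply: Or32|by apply: Or32|by apply: Or31].
case=> [?|[_ ?]|[_ ?]]; [by apply: Or33|by apply: Or31|by apply: Or33].
Qed.

(** The rest of a cycle through an edge joins the two ends of that edge, which is therefore not a
    bridge. *)
Lemma bridges_acyclic E :
  (forall e, e \in E -> ~~ connect (adj (E :\ e)) e.1 e.2) -> acyclic_graph E.
Proof.
move=> br [//|x [//|y s]] u s_gt0; apply/negP.
rewrite /cycle rcons_cons => /andP[xy]; rewrite -/(path _ y _) rcons_path.
move=> /andP[ys lx].
have [xNys ys_uniq] : x \notin y :: s /\ uniq (y :: s) by apply/andP.
(* A cycle has at least three vertices, so the edge closing it is not the edge between [x] and [y]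
   again. *)
have lNy : last y s != y.
  move: s_gt0 ys_uniq => {u lx ys xNys}; case: s => // z s _ /= /andP[yNs _].
  by apply: contraNneq yNs => <-; rewrite mem_last.
(* Both orientations are allowed for [e], since [adj] does not tell which one is stored in [E]. *)
have key e : e = (x, y) \/ e = (y, x) -> connect (adj (E :\ e)) x y.
  move=> ee; rewrite connect_adj_sym.
  apply: (@connect_trans _ _ (last y s)).
    apply/connectP; exists s => //.
    have allx : all (predC1 x) (y :: s).
      by apply/allP => a ays; apply: contraNneq xNys => <-.
    apply: (sub_in_path _ allx ys).
    move=> a b; rewrite /adj !inE => ax bx.
    have -> : (a, b) != e.
      by case: ee => ->; rewrite xpair_eqE negb_and ?ax ?bx ?orbT.
    have -> // : (b, a) != e.
    by case: ee => ->; rewrite xpair_eqE negb_and ?ax ?bx ?orbT.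
  apply: connect1; move: lx; rewrite /adj !inE.
  have yx : y != x by apply: contraNneq xNys => ->; rewrite mem_head.
  have -> : (last y s, x) != e.
    by case: ee => ->; rewrite xpair_eqE negb_and ?lNy // [x == y]eq_sym yx orbT.
  have -> // : (x, last y s) != e.
  by case: ee => ->; rewrite xpair_eqE negb_and ?lNy ?orbT // [x == y]eq_sym yx.
move: xy => /orP[] /[dup] eE /br /=; first by rewrite key//; left.
by rewrite connect_adj_sym key//; right.
Qed.

Lemma simple_edgesS E F : E \subset F -> simple_edges F -> simple_edges E.
Proof.
move=> /subsetP EF /forall_inP sF; apply/forall_inP => e /EF; exact: sF.
Qed.

(** Edges that are not bridges are deleted one at a time; connectivity survives, and when only
    bridges remain the graph is a tree. *)
Lemma connected_has_spanning_tree E : simple_edges E -> connected_graph E ->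
  exists2 T : {set 'I_n * 'I_n}, T \subset E & spanning_tree T.
Proof.
have [k] := ubnP #|E|; elim: k E => // k IH E Ek sE cE.
have [/forall_inP br|] :=
  boolP [forall e in E, ~~ connect (adj (E :\ e)) e.1 e.2].
  by exists E => //; split=> //; apply: bridges_acyclic.
rewrite negb_forall_in => /exists_inP[e eE /negPn ce].
have sub : E :\ e \subset E by rewrite subsetDl.
have [|T TE sT] := IH _ _ (simple_edgesS sub sE) (connected_setD1 cE ce).
  by move: Ek; rewrite (cardsD1 e E) eE.
by exists T => //; apply: subset_trans sub.
Qed.

Lemma exists_spanning_tree : exists T : {set 'I_n * 'I_n}, spanning_tree T.
Proof.
have [||T _ ?] := @connected_has_spanning_tree [set e : 'I_n * 'I_n | (e.1 < e.2)%N].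
- by apply/forall_inP => e; rewrite inE.
- move=> x y; have [->//|] := eqVneq x y.
  rewrite -val_eqE neq_ltn => xy.
  by apply: connect1; rewrite /adj !inE.
- by exists T.
Qed.

(** Deleting a bridge splits one component in two, so each edge of [L] yields a new component; [A]
    collects representatives of distinct components. *)
Lemma bridges_separate E L : L \subset E ->
  (forall e, e \in E -> ~~ connect (adj (E :\ e)) e.1 e.2) ->
  exists A : {set 'I_n}, #|A| = #|L| /\
    {in A &, forall x y, x != y -> ~~ connect (adj (E :\: L)) x y}.
Proof.
move=> + br; have [k] := ubnP #|L|; elim: k L => // k IH L Lk LE.
have [->|[e eL]] := set_0Vmem L.
  by exists set0; rewrite !cards0; split=> // x y; rewrite inE.
have eE := subsetP LE _ eL.
have [||A [cA sA]] := IH (L :\ e).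
- by move: Lk; rewrite (cardsD1 e L) eL.
- by rewrite (subset_trans _ LE) ?subsetDl.
have mono x y : connect (adj (E :\: L)) x y -> connect (adj (E :\: (L :\ e))) x y.
  by apply: connect_adjS; rewrite setDS ?subsetDl.
have ce : connect (adj (E :\: (L :\ e))) e.1 e.2.
  by apply: connect_edge; rewrite !inE eqxx.
have nce : ~~ connect (adj (E :\: L)) e.1 e.2.
  apply: contra (br _ eE); apply: connect_adjS.
  by rewrite setDS ?sub1set.
(* Before [e] is removed, at most one point of [A] is joined to its ends. If that point remains
   joined to [e.1], then [e.2] is the new representative; otherwise [e.1] is. *)
have [v nv] : exists v, forall a, a \in A -> ~~ connect (adj (E :\: L)) a v.
  have [/exists_inP[a aA ac]|] :=
    boolP [exists a in A, connect (adj (E :\: L)) a e.1]; last first.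
    by rewrite negb_exists_in => /forall_inP ?; exists e.1.
  exists e.2 => b bA; apply/negP => bc.
  have eab : a = b.
    apply/eqP/negPn/negP => /(sA _ _ aA bA) /negP; apply.
    apply: connect_trans (mono _ _ ac) (connect_trans ce _).
    by rewrite connect_adj_sym mono.
  move: nce => /negP; apply; rewrite connect_adj_sym in ac.
  by apply: connect_trans ac _; rewrite eab.
exists (v |: A); split.
  rewrite cardsU1 cA (cardsD1 e L) eL; congr (_ + _)%N.
  by have [/nv|//] := boolP (v \in A); rewrite connect0.
move=> x y; rewrite !inE => /predU1P[->|xA] /predU1P[->|yA]; first by rewrite eqxx.
- by move=> _; rewrite connect_adj_sym nv.
- by move=> _; rewrite nv.
- by move=> xy; apply: contra (sA _ _ xA yA xy) => /mono.
Qed.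

(** As [n > 1], every vertex has a neighbour, so the ends of the edges exhaust the vertices. This is
    cruder than [n - 1] edges, but only affects a constant. *)
Lemma connected_card_edges E : (1 < n)%N -> connected_graph E ->
  (n <= (#|E|).*2)%N.
Proof.
move=> n1 cE.
pose S := [set e.1 | e in E] :|: [set e.2 | e in E].
have SE : (#|S| <= (#|E|).*2)%N.
  by rewrite -addnn (leq_trans (leq_card_setU _ _)) // leq_add ?leq_imset_card.
suff /subset_leq_card : setT \subset S.
  by rewrite cardsT card_ord => /leq_trans; apply.
apply/subsetP => x _.
have [y xy] : exists y, y != x.
  have : (0 < #|predC1 x|)%N by rewrite cardC1 card_ord -ltnS prednK ?(ltnW n1).
  by case/card_gt0P => y; exists y.
have /connectP[[|z p] /= ] := cE x y.
  by move=> _ yx; rewrite yx eqxx in xy.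
case/andP => /orP[] xz _ _; apply/setUP; [left|right].
  by apply/imsetP; exists (x, z).
by apply/imsetP; exists (z, x).
Qed.

End Graphs.

(** * Exchange arguments for minimal spanning trees *)

Section MinimalSpanningTrees.
Import fintype mathcomp.boot.finset.
Variables (R : realType) (M : Type) (d : M -> M -> R).
Hypothesis d_metric : is_metric d.
Variables (n : nat) (p : 'I_n -> M).
Implicit Types (E F L T : {set 'I_n * 'I_n}) (e f : 'I_n * 'I_n).

Let d_ge0 x y : 0 <= d x y. Proof. by case: d_metric. Qed.
Let d_sym x y : d x y = d y x. Proof. by case: d_metric. Qed.

Local Notation len e := (d (p e.1) (p e.2)).

Lemma edge_energy1 E : edge_energy d p E 1 = \sum_(e in E) len e.
Proof. by apply: eq_bigr => e _; rewrite powRr1. Qed.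

Lemma edge_energy1S E F : E \subset F -> edge_energy d p E 1 <= edge_energy d p F 1.
Proof.
move=> EF; rewrite !edge_energy1 [leRHS](big_setID E) /= (setIidPr EF).
by rewrite lerDl sumr_ge0.
Qed.

Lemma edge_energy1_setU1 E f :
  edge_energy d p (f |: E) 1 <= len f + edge_energy d p E 1.
Proof.
rewrite !edge_energy1; have [fE|fE] := boolP (f \in E); last by rewrite big_setU1.
by rewrite (setUidPr _) ?sub1set// lerDr.
Qed.

Lemma edge_energy1_setD1 E e : e \in E ->
  edge_energy d p E 1 = len e + edge_energy d p (E :\ e) 1.
Proof. by move=> eE; rewrite !edge_energy1 (big_setD1 e). Qed.

Lemma exists_MST : exists E, is_MST d p E.
Proof.
have [T sT] := exists_spanning_tree n.
case: (@arg_minP _ _ _ T (fun E => `[< spanning_tree E >])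
  (fun E => edge_energy d p E 1)) => [|E /asboolP sE minE]; first exact/asboolP.
by exists E; split=> // F sF; apply/minE/asboolP.
Qed.

(** Passing to a spanning tree inside [F] only lowers the length. Competitors of an MST thus need
    only be connected, with no check of acyclicity. *)
Lemma MST_le_connected E F : is_MST d p E -> simple_edges F ->
  connected_graph F -> edge_energy d p E 1 <= edge_energy d p F 1.
Proof.
move=> [_ minE] sF /(connected_has_spanning_tree sF)[T TF /minE].
by move=> /le_trans; apply; apply: edge_energy1S.
Qed.

(** Deleting an edge that is not a bridge would leave a connected graph that is strictly shorter,
    since distinct points are at positive distance. *)
Lemma MST_bridge E e : injective p -> is_MST d p E -> e \in E ->
  ~~ connect (adj (E :\ e)) e.1 e.2.
Proof.
move=> p_inj mE eE; have [[sE cE _] _] := mE.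
apply/negP => /(connected_setD1 cE) /(MST_le_connected mE).
move=> /(_ (simple_edgesS (subsetDl _ _) sE)).
rewrite (edge_energy1_setD1 eE) gerDr => len0.
have /p_inj ee : p e.1 = p e.2.
  by case: d_metric => _ d0 _ _; apply/d0/le_anti; rewrite len0 d_ge0.
by have /forall_inP/(_ _ eE) := sE; rewrite ee ltnn.
Qed.

Lemma MST_exchange E t x y : is_MST d p E ->
  ~~ connect (adj (E :\: [set e in E | t <= len e])) x y -> t <= d (p x) (p y).
Proof.
set L := [set _ in _ | _] => mE ncL; have [[sE cE _] _] := mE.
(* If K is minimal among the subsets of L whose removal separates x from y,
   then returning any e in K reconnects them through e, so that e can be traded
   for the edge between x and y. *)
pose P (K : {set 'I_n * 'I_n}) := (K \subset L) && ~~ connect (adj (E :\: K)) x y.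
have [|K /minsetP[/andP[KL ncK] minK] _] := @minset_exists _ P L.
  by rewrite /P subxx.
have [K0|[e eK]] := set_0Vmem K.
  by move: ncK; rewrite K0 setD0 cE.
have [eE te] : e \in E /\ t <= len e.
  by have := subsetP KL _ eK; rewrite inE => /andP[].
have EK : E :\: (K :\ e) = e |: (E :\: K).
  apply/setP => f; rewrite !inE; have [->|] := eqVneq f e; first by rewrite eE.
  by rewrite andTb.
have cK : connect (adj (e |: (E :\: K))) x y.
  rewrite -EK; apply/negPn/negP => nc.
  have /minK/(_ (subsetDl _ _)) eqK : P (K :\ e).
    by rewrite /P nc andbT (subset_trans (subsetDl _ _) KL).
  by move: eK; rewrite -{1}eqK !inE eqxx.
have xy : x != y by apply: contraNneq ncK => ->; exact: connect0.
(* Edges are stored with increasing ends, so [f] is whichever orientation of the pair is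
   admissible. *)
have [f ff lf] : exists2 f : 'I_n * 'I_n, (f.1 < f.2)%N & (f = (x, y) \/ f = (y, x)).
  by move: xy; rewrite -val_eqE neq_ltn => /orP[] ?;
     [exists (x, y)|exists (y, x)] => //; [left|right].
have len_f : len f = d (p x) (p y) by case: lf => -> /=.
pose F := f |: (E :\ e).
have cfF : connect (adj F) x y.
  by apply: connect1; rewrite /adj !inE; case: lf => ->; rewrite eqxx ?orbT.
have EKF a b : connect (adj (E :\: K)) a b -> connect (adj F) a b.
  apply: connect_adjS; apply: subset_trans (subsetUr _ _).
  by rewrite setDS// sub1set.
(* The path of [cK] must cross [e], so [E :\: K] links [x] and [y] to opposite ends of [e]; together
   with [f] this is a detour around [e]. *)
have ceF : connect (adj F) e.1 e.2.
  have csym := connect_adj_sym F.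
  case: (connect_setU1 cK) => [|[/EKF c1 /EKF c2]|[/EKF c1 /EKF c2]].
  - by rewrite (negPf ncK).
  - rewrite csym in c1; apply: connect_trans c1 (connect_trans cfF _).
    by rewrite csym.
  - rewrite csym; rewrite csym in c1; apply: connect_trans c1 (connect_trans cfF _).
    by rewrite csym.
have cF : connected_graph F.
  move=> a b; apply: connect_adj_sub (cE a b) => g gE.
  have [->//|ge] := eqVneq g e.
  by apply: connect_edge; rewrite !inE ge gE orbT.
have sF : simple_edges F.
  apply/forall_inP => g; rewrite !inE => /predU1P[->//|/andP[_ gE]].
  exact: (forall_inP sE).
have := le_trans (MST_le_connected mE sF cF) (edge_energy1_setU1 _ _).
by rewrite (edge_energy1_setD1 eE) lerD2r len_f; apply: le_trans.
Qed.

Lemma MST_long_edges_packing (x0 : M) E t : injective p -> is_MST d p E ->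
  exists q, disjoint_balls d (t / 2) #|[set e in E | t <= len e]| q.
Proof.
set L := [set _ in _ | _] => p_inj mE.
have LE : L \subset E by apply/subsetP => e; rewrite inE => /andP[].
have [A [cA sA]] := bridges_separate LE (fun e => MST_bridge p_inj mE).
(* The centres are the separated vertices: [MST_exchange] puts them at distance at least [t], so a
   common point of two balls of radius [t / 2] would violate the triangle inequality. Beyond the
   size of [A] the default [x0] appears, on which [disjoint_balls] says nothing. *)
exists (nth x0 [seq p x | x <- enum A]) => i j /andP[ij jL] y [iy jy].
have jA : (j < size (enum A))%N by rewrite -cardE cA.
have iA := ltn_trans ij jA.
have [a _] : exists a, a \in enum A.
  by move: jA; case: (enum A) => // a s; exists a; rewrite mem_head.
move: iy jy; rewrite !(nth_map a) //; set b := nth _ _ _; set c := nth _ _ _.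
have bA : b \in A by rewrite -mem_enum mem_nth.
have cAA : c \in A by rewrite -mem_enum mem_nth.
have bc : b != c by rewrite nth_uniq ?enum_uniq// ltn_eqF.
have /(MST_exchange mE) := sA _ _ bA cAA bc.
have := let: And4 _ _ _ tri := d_metric in tri (p b) y (p c).
rewrite [d y _]d_sym; lra.
Qed.

End MinimalSpanningTrees.

(** * Summation over dyadic scales *)

Section DyadicSum.
Variable R : realType.
Implicit Types (q x D K s a : R).

Lemma geometric_sum_le q n : 0 <= q < 1 -> \sum_(i < n) q ^+ i <= (1 - q)^-1.
Proof.
move=> /andP[q0 q1]; rewrite -div1r ler_pdivlMr ?subr_gt0// mulrC.
have := subrX1 q n; have := exprn_ge0 n q0; nra.
Qed.

(** The least [j] whose scale is below [x] works: the preceding scale exceeds [x], and for [j = 0]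
    the bound [x <= D] takes its place. *)
Lemma dyadic_scale D x : 0 < x <= D ->
  exists j, D * 2^-1 ^+ j <= x <= 2 * (D * 2^-1 ^+ j).
Proof.
move=> /andP[x0 xD]; have D0 := lt_le_trans x0 xD.
have ex : exists j, D * 2^-1 ^+ j <= x.
  exists (Num.bound (D / x)).
  rewrite exprVn ler_pdivrMr ?exprn_gt0// -ler_pdivrMl// mulrC ltW//.
  exact: upper_nthrootP.
case: (ex_minnP ex) => -[|j] jx jmin; [exists 0%N|exists j.+1].
  by rewrite jx expr0; lra.
rewrite jx /=; have := jmin j; rewrite ltnn; case: leP => [_ /(_ isT)//|lt _].
by rewrite exprS; lra.
Qed.

(** At scale [t = D / 2 ^ j] at most [K * t ^ (- s)] terms count, each at most [(2 * t) ^ a]. The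
    total is a geometric series of ratio [2 ^ (s - a)], which is below 1 because [s < a]. *)
Lemma dyadic_sum_le (I : finType) (A : {set I}) (l : I -> R) D K s a :
  0 < D -> 0 <= a -> s < a -> (forall i, i \in A -> 0 < l i <= D) ->
  (forall t, 0 < t <= D -> #|[set i in A | t <= l i]|%:R <= K * t `^ (- s)) ->
  \sum_(i in A) l i `^ a
    <= K * 2 `^ a * D `^ (a - s) * (1 - 2^-1 `^ (a - s))^-1.
Proof.
move=> D0 a0 sa lD cardA.
pose t j := D * 2^-1 ^+ j.
have t0 j : 0 < t j by rewrite mulr_gt0// exprn_gt0.
have tD j : t j <= D by rewrite ger_pMr// exprn_ile1//; lra.
have K0 : 0 <= K.
  have := cardA D; rewrite D0 lexx => /(_ isT); rewrite -ler_pdivrMr ?powR_gt0//.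
  by apply: le_trans; rewrite divr_ge0 ?powR_ge0.
have /choice[jj jjP] : forall i, exists j, i \in A -> t j <= l i <= 2 * t j.
  move=> i.
  have [iA|iA] := boolP (i \in A); last by exists 0%N.
  by have [j ?] := dyadic_scale (lD _ iA); exists j.
pose J := (\max_(i in A) jj i).+1.
(* Each [i] is charged at every scale below [l i], not only at its own; the overcount makes the
   inner sums match the counts in [cardA]. *)
have step1 : \sum_(i in A) l i `^ a <=
    \sum_(i in A) \sum_(j < J | t j <= l i) (2 * t j) `^ a.
  apply: ler_sum => i iA; have /andP[tl lt] := jjP _ iA.
  have jJ : (jj i < J)%N by rewrite ltnS; apply: leq_bigmax_cond.
  rewrite (bigD1 (Ordinal jJ))//= -[leLHS]addr0 lerD ?sumr_ge0//; last first.
    by move=> j _; rewrite powR_ge0.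
  apply: ge0_ler_powR => //; rewrite nnegrE ?mulr_ge0 ?ltW//.
  by have /andP[] := lD _ iA.
apply: (le_trans step1); rewrite (exchange_big_dep xpredT)//=.
have step2 (j : 'I_J) : true -> \sum_(i in A | t j <= l i) (2 * t j) `^ a <=
    K * 2 `^ a * D `^ (a - s) * (2^-1 `^ (a - s)) ^+ j.
  move=> _.
  rewrite (eq_bigl (fun i => i \in [set i in A | t j <= l i]%SET)); last first.
    by move=> i; rewrite inE.
  rewrite sumr_const -[leLHS]mulr_natl.
  apply: le_trans (ler_wpM2r (powR_ge0 _ _) (cardA _ _)) _; first by rewrite t0 tD.
  rewrite [(2 * _) `^ a]powRM ?(ltW (t0 j))// -!mulrA ler_wpM2l// mulrCA ler_wpM2l ?powR_ge0//.
  rewrite -powRD; last by rewrite (gt_eqF (t0 j)) implybT.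
  rewrite [- s + a]addrC /t powRM ?exprn_ge0 ?(ltW D0)//.
  by rewrite -!powR_mulrn ?powR_ge0// -!powRrM [_ * (a - s)]mulrC.
apply: le_trans (ler_sum _ step2) _; rewrite -mulr_sumr ler_wpM2l//.
  by rewrite !mulr_ge0 ?powR_ge0.
apply: geometric_sum_le; rewrite powR_ge0 /=.
have one_powR : 1 `^ (a - s) = 1 by rewrite powR1.
by rewrite -[ltRHS]one_powR gt0_ltr_powR ?subr_gt0 ?nnegrE//; lra.
Qed.

End DyadicSum.

(** * Packing numbers, box dimension and the two inequalities *)

Section BoxDimension.
Variables (R : realType) (M : Type) (d : M -> M -> R).
Hypothesis d_metric : is_metric d.
Implicit Types (x y : M) (q : nat -> M) (eps B s a : R).

Let d_ge0 x y : 0 <= d x y. Proof. by case: d_metric. Qed.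
Let d_sym x y : d x y = d y x. Proof. by case: d_metric. Qed.
Let dxx x : d x x = 0. Proof. by case: d_metric => _ d0 _ _; apply/d0. Qed.
Let d_tri x y z : d x z <= d x y + d y z. Proof. by case: d_metric. Qed.

Lemma disjoint_balls_le eps eps' n q : eps <= eps' ->
  disjoint_balls d eps' n q -> disjoint_balls d eps n q.
Proof.
move=> ee dq i j ij y [iy jy]; apply: (dq i j ij y).
by split; apply: lt_le_trans ee.
Qed.

Lemma disjoint_balls_dist eps n q i j : 0 < eps -> disjoint_balls d eps n q ->
  (i < j < n)%N -> eps <= d (q i) (q j).
Proof.
move=> e0 dq ij; rewrite leNgt; apply/negP => lt.
by apply: (dq i j ij (q j)); rewrite dxx.
Qed.

Lemma disjoint_balls_packing eps n q : disjoint_balls d eps n q ->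
  (n%:R%:E <= packing_number d eps)%E.
Proof. by move=> dq; apply: ereal_sup_ubound; exists n => //; exists q. Qed.

(** One ball is vacuously a packing. This bound excludes [-oo] and makes the logarithm of a finite
    packing number nonnegative. *)
Lemma packing_number_ge1 x eps : (1 <= packing_number d eps)%E.
Proof.
apply: (@disjoint_balls_packing eps 1 (fun=> x)) => i j /andP[ij].
by rewrite ltnS leqn0 => /eqP j0; rewrite j0 in ij.
Qed.

Lemma ln_inv_gt0 eps : 0 < eps < 1 -> 0 < ln (1 / eps).
Proof. by move=> /andP[e0 e1]; rewrite ln_gt0// ltr_pdivlMr// mul1r. Qed.

Lemma box_ratio_ge0 x eps : 0 < eps < 1 -> (0 <= box_ratio d eps)%E.
Proof.
move=> e01; rewrite /box_ratio; have := packing_number_ge1 x eps.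
case: (packing_number d eps) => //= N; rewrite !lee_fin => N1.
by rewrite divr_ge0 ?(ltW (ln_inv_gt0 e01)) ?ln_ge0.
Qed.

Lemma box_ratio_le eps B : M -> 0 < eps < 1 ->
  (forall n q, disjoint_balls d eps n q -> n%:R <= B) ->
  (box_ratio d eps <= (ln B / ln (1 / eps))%:E)%E.
Proof.
move=> x e01 dB; rewrite /box_ratio; have := packing_number_ge1 x eps.
have : (packing_number d eps <= B%:E)%E.
  by apply: ge_ereal_sup => _ [n [q /dB ?] <-]; rewrite lee_fin.
case: (packing_number d eps) => //= N; rewrite !lee_fin => NB N1.
rewrite ler_pM2r ?invr_gt0 ?ln_inv_gt0// ler_ln// posrE.
  exact: lt_le_trans N1.
exact: lt_le_trans (le_trans N1 NB).
Qed.

Lemma disjoint_balls_card_le eps s n q : M -> 0 < eps < 1 ->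
  (box_ratio d eps <= s%:E)%E -> disjoint_balls d eps n q -> n%:R <= eps `^ (- s).
Proof.
move=> x e01 + /disjoint_balls_packing; have /andP[e0 e1] := e01.
rewrite /box_ratio; have := packing_number_ge1 x eps.
case: (packing_number d eps) => //= N; rewrite !lee_fin => N1 Ns /le_trans; apply.
have N0 : 0 < N by apply: lt_le_trans N1.
rewrite -ler_ln ?posrE ?powR_gt0// ln_powR mulNr -mulrN -lnV ?posrE//.
by rewrite -div1r -ler_pdivrMr// ln_inv_gt0.
Qed.

(** In a packing of maximal size every point lies within [2 * eps] of some centre, as it could
    otherwise be added; the finitely many centres lie within [S] of [x0]. *)
Lemma totally_bounded_diameter eps B : M ->
  (forall n q, disjoint_balls d eps n q -> n%:R <= B) ->
  exists D, forall x y, d x y <= D.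
Proof.
move=> x0 dB; pose P n := `[< exists q, disjoint_balls d eps n q >].
have P0 : exists n, P n by exists 0%N; apply/asboolP; exists (fun=> x0) => i j /andP[].
have PB n : P n -> (n <= Num.bound B)%N.
  move=> /asboolP[q /dB nB]; rewrite -(ler_nat R) (le_trans nB)// ltW//.
  by rewrite archi_boundP// (le_trans _ nB).
case: (ex_maxnP P0 PB) => n /asboolP[q dq] nmax.
pose S := \sum_(i < n) d (q i) x0.
have center x : d x x0 <= 2 * eps + S.
  rewrite leNgt; apply/negP => far.
  suff /nmax : P n.+1 by rewrite ltnn.
  (* The far point [x] is appended at index [n]. *)
  apply/asboolP; exists (fun i => if (i < n)%N then q i else x) => i j /andP[ij].
  rewrite ltnS leq_eqVlt => /predU1P[jn y|jn]; last first.
    by rewrite (ltn_trans ij jn) jn; apply: dq; rewrite ij.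
  rewrite jn ltnn -{1}jn ij => -[iy xy].
  have iS : d (q i) x0 <= S.
    have i_lt : (i < n)%N by rewrite -jn.
    by rewrite /S (bigD1 (Ordinal i_lt))//= lerDl sumr_ge0.
  have := d_tri x y x0; have := d_tri y (q i) x0; rewrite (d_sym y (q i)); lra.
exists (2 * (2 * eps + S)) => x y.
have := d_tri x x0 y; have := center x; have := center y; rewrite (d_sym y); lra.
Qed.

Lemma dim_Box_ge0 : M -> (0 <= dim_Box d)%E.
Proof.
move=> x; apply: le_ereal_inf_tmp => _ [delta /= /andP[d0 d1] <-].
apply: le_ereal_sup_tmp; exists (box_ratio d (delta / 2)).
  by exists (delta / 2) => //=; lra.
by apply: (box_ratio_ge0 x); lra.
Qed.

(** Some supremum over [0 < eps < delta] lies below [a]; being also nonnegative it is a real [s].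
    The gap between [s] and [a] is what makes the dyadic sum converge. *)
Lemma dim_Box_lt_packing a : M -> (dim_Box d < a%:E)%E ->
  exists delta s, [/\ 0 < delta < 1, 0 <= s < a & forall eps n q,
    0 < eps < delta -> disjoint_balls d eps n q -> n%:R <= eps `^ (- s)].
Proof.
move=> x /ereal_inf_lt[_ [delta /= d01 <-]]; set S := ereal_sup _ => Sa.
have ratioS eps : 0 < eps < delta -> (box_ratio d eps <= S)%E.
  by move=> e0; apply: ereal_sup_ubound; exists eps.
have S0 : (0 <= S)%E.
  by apply: le_trans (ratioS (delta / 2) _); [apply: (box_ratio_ge0 x)|]; lra.
move: Sa S0 ratioS; case: S => //= s; rewrite lte_fin lee_fin => sa s0 ratios.
exists delta, s; split=> // [|eps n q ed]; first by rewrite s0.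
by apply: disjoint_balls_card_le (ratios _ ed) => //; lra.
Qed.

Lemma MST_energy_bounded a : M -> (dim_Box d < a%:E)%E ->
  exists C, forall (n : nat) (p : 'I_n -> M), injective p ->
    forall E, is_MST d p E -> edge_energy d p E a <= C.
Proof.
move=> x /(dim_Box_lt_packing x)[delta [s [d01 /andP[s0 sa] card_le]]].
have [||D0 dD0] := @totally_bounded_diameter (delta / 2) ((delta / 2) `^ (- s)) => //.
  by move=> n q; apply: card_le; lra.
pose D := Num.max D0 1.
have D1 : 1 <= D by rewrite le_max lexx orbT.
have dD y z : d y z <= D by rewrite le_max dD0.
(* The packing bound holds only below [delta], whereas edge lengths range up to [D]. The rescaled
   radius [delta / (2 * D) * t] is below [delta] for all [t <= D], and at most [t / 2] because
   [delta < 1 <= D]. *)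
pose K := (delta / (2 * D)) `^ (- s).
exists (K * 2 `^ a * D `^ (a - s) * (1 - 2^-1 `^ (a - s))^-1) => n p p_inj E mE.
apply: (dyadic_sum_le (l := fun e => d (p e.1) (p e.2))) => //; [lra..| |].
- move=> e eE; rewrite dD andbT lt_neqAle d_ge0 andbT eq_sym.
  apply: contra (MST_bridge d_metric p_inj mE eE) => /eqP.
  by case: d_metric => _ d0 _ _ /d0/p_inj ->; rewrite connect0.
move=> t /andP[t0 tD].
have [q dq] := MST_long_edges_packing d_metric x t p_inj mE.
have D2 : 0 < 2 * D by lra.
have eps0 : 0 < delta / (2 * D) * t by rewrite mulr_gt0// divr_gt0//; lra.
rewrite -powRM ?divr_ge0 ?(ltW t0) ?(ltW D2)//; last by lra.
apply: card_le; last apply: disjoint_balls_le dq.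
  rewrite eps0/= mulrAC ltr_pdivrMr//; nra.
rewrite mulrAC ler_pdivrMr//; nra.
Qed.

Lemma packing_le_MST_energy a C eps n q : 0 <= a -> 0 < eps < 1 ->
  (forall (n : nat) (p : 'I_n -> M), injective p ->
     forall E, is_MST d p E -> edge_energy d p E a <= C) ->
  disjoint_balls d eps n q -> n%:R <= (1 + 2 * `|C|) * eps `^ (- a).
Proof.
move=> a0 /andP[e0 e1] EC dq; rewrite powRN ler_pdivlMr ?powR_gt0//.
have ea1 : eps `^ a <= 1.
  by rewrite -(powRr0 eps) ger_powR// e0 ltW.
have ea0 := powR_ge0 eps a; have C0 := normr_ge0 C.
(* With at most one point there need be no edge; the summand 1 in the constant covers this case. *)
have [n1|n1] := leqP n 1.
  have : n%:R <= 1 :> R by rewrite (ler_nat _ _ 1).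
  have : 0 <= n%:R :> R by []. nra.
pose p (i : 'I_n) := q i.
have far (i j : 'I_n) : i != j -> eps <= d (p i) (p j).
  rewrite -val_eqE neq_ltn => /orP[] ij; last rewrite d_sym;
    by apply: disjoint_balls_dist dq _ => //; rewrite ij ltn_ord.
have p_inj : injective p.
  move=> i j ij; apply/eqP/negPn/negP => /far.
  by rewrite ij dxx leNgt e0.
have [E mE] := exists_MST d p.
have [[sE cE _] _] := mE.
have := connected_card_edges n1 cE; rewrite -(ler_nat R) -mul2n natrM => nE.
have : #|E|%:R * eps `^ a <= C.
  apply: le_trans (EC _ _ p_inj _ mE).
  rewrite /edge_energy mulr_natl -sumr_const; apply: ler_sum => e eE.
  rewrite ge0_ler_powR ?nnegrE ?(ltW e0)// far//.
  by have /forall_inP/(_ _ eE) := sE; apply: contraTneq => ->; rewrite ltnn.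
have := ler_norm C; nra.
Qed.

Lemma dim_Box_le_MST_exponent a C : M -> 0 <= a ->
  (forall (n : nat) (p : 'I_n -> M), injective p ->
     forall E, is_MST d p E -> edge_energy d p E a <= C) ->
  (dim_Box d <= a%:E)%E.
Proof.
move=> x a0 EC; apply/lee_addgt0Pr => eta eta0.
pose K := 1 + 2 * `|C|; have C0 := normr_ge0 C.
have K1 : 1 <= K by rewrite /K; lra.
(* The constant [K] adds [ln K / ln (1 / eps)] to the box ratio, which is at most [eta] as soon as
   [eps < expR (- (ln K / eta))]; the minimum with [2^-1] keeps [delta] below 1. *)
pose delta := Num.min 2^-1 (expR (- (ln K / eta))).
apply: ge_ereal_inf; eexists.
  exists delta => //=; rewrite lt_min expR_gt0 gt_min; lra.
apply: ge_ereal_sup => _ [eps /= /andP[e0 +] <-].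
rewrite lt_min => /andP[e2 eK].
have e01 : 0 < eps < 1 by lra.
have L0 := ln_inv_gt0 e01.
apply: le_trans (box_ratio_le x e01 _) _.
  move=> n q; exact: packing_le_MST_energy EC.
rewrite -EFinD lee_fin ler_pdivrMr// lnM ?posrE ?powR_gt0//.
have lnE : ln (1 / eps) = - ln eps by rewrite div1r lnV.
rewrite ln_powR lnE [leRHS]mulrDl [leRHS]addrC lerD//; last by rewrite mulrN mulNr.
rewrite [leRHS]mulrC -ler_pdivrMr// lerNr ltW//.
by rewrite -[ltRHS]expRK ltr_ln// posrE expR_gt0.
Qed.

End BoxDimension.

Theorem theorem2 (R : realType) (M : Type) (d : M -> M -> R) :
  is_metric d -> inhabited M -> dim_MST d = dim_Box d.
Proof.
move=> d_metric [x]; apply/eqP; rewrite eq_le; apply/andP; split; last first.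
  apply: le_ereal_inf_tmp => _ [a [a0 [C EC]] <-].
  exact: (dim_Box_le_MST_exponent d_metric x a0 EC).
have MSTle (a : R) : (dim_Box d < a%:E)%E -> (dim_MST d <= a%:E)%E.
  move=> da; apply: ereal_inf_lbound; exists a => //; split.
    by rewrite -lee_fin (le_trans (dim_Box_ge0 d x)) ?ltW.
  exact: (MST_energy_bounded d_metric x da).
(* A finite box dimension is approached from above by admissible exponents; the value [+oo] is a
   trivial bound, and [-oo] is excluded by nonnegativity. *)
have := dim_Box_ge0 d x.
case: (dim_Box d) MSTle => [r MSTle _|_ _|//]; last exact: leey.
by apply/lee_addgt0Pr => e e0; rewrite -EFinD MSTle// lte_fin ltrDl.
Qed.
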